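(* Let $(x_1,\ldots,x_N)$ be an ordered $N$-tuple of distinct points in $\mathbb{R}^3$ satisfying the following two conditions: (i) the first $m$ points $x_1,\ldots,x_m$ lie on a line $L$; (ii) the remaining $n=N-m$ points $y_j=x_{m+j+1}$ $(j=0,1,\ldots,n-1)$ are the vertices of a regular $n$-gon whose plane is perpendicular to $L$, and whose centroid lies on $L$. Then Atiyah's conjecture is valid for this configuration: the associated polynomials $p_1,\ldots,p_N\in\mathbb{C}[x,y]$ (homogeneous of degree $N-1$, each determined up to a nonzero scalar factor) are linearly independent.
   Context: Associated polynomials. Let $(x_1,\ldots,x_N)$ be an ordered $N$-tuple of distinct points in $\mathbb{R}^3$. Each ordered pair $(x_i,x_j)$ with $i\neq j$ determines the point $\frac{x_j-x_i}{|x_j-x_i|}$ of the unit sphere $S^2\subset\mathbb{R}^3$. Identify $S^2$ with the complex projective line $\mathbb{CP}^1$ by using a stereographic projection. This gives a point $(u_{ij},v_{ij})\in\mathbb{CP}^1$ (homogeneous coordinates) and a nonzero linear form $l_{ij}=u_{ij}x+v_{ij}y\in\mathbb{C}[x,y]$, determined up to a nonzero scalar. Define $$p_i=\prod_{j\ne i} l_{ij}(x,y),\qquad i=1,\ldots,N.$$ Atiyah's conjecture asserts that $p_1,\ldots,p_N$ are linearly independent. Concrete form of the identification. Identify $\mathbb{R}^3$ with $\mathbb{R}\times\mathbb{C}$ and use the Hopf map $h:\mathbb{C}^2\setminus\{0\}\to(\mathbb{R}\times\mathbb{C})\setminus\{0\}$, $h(z,w)=\left((|z|^2-|w|^2)/2,\;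 z\bar w\right)$, which is surjective with fibers the circles $\{(zu,wu): u\in\mathbb{C},\ |u|=1\}$. For $i\ne j$ one takes $(u_{ij},v_{ij})$ to be an element of $\mathbb{C}^2$ with $h(u_{ij},v_{ij})=x_j-x_i$, up to a nonzero scalar. Normalization of the configuration. Without loss of generality, $L=\mathbb{R}\times\{0\}$, $x_i=(a_i,0)$ for $i=1,\ldots,m$ with $a_1<a_2<\cdots<a_m$ real, and the $y_j$ lie on the unit circle in $\{0\}\times\mathbb{C}$, with $y_j=(0,-\zeta^j)$ for $j=0,1,\ldots,n-1$, where $\zeta=e^{2\pi i/n}$ (here $i$ in the exponent is the imaginary unit). The cases $n=1$ and $n=2$, in which the configuration is planar, are understood through this normal form: for $n=1$ the single point is $y_0=(0,-1)$, which is not on $L$; for $n=2$ the two points are $(0,-1)$ and $(0,1)$. *)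

(* Defs.v *)
From HB Require Import structures.
From mathcomp Require Import all_boot all_order all_algebra all_fingroup.
From mathcomp Require Import complex mpoly.
From mathcomp Require Import reals trigo.

Set Implicit Arguments.
Unset Strict Implicit.
Unset Printing Implicit Defensive.

Import Order.TTheory GRing.Theory Num.Theory.
Local Open Scope ring_scope.
Local Open Scope complex_scope.

Definition dot (R : realType) (a b : 'rV[R]_3) : R := \sum_k a 0 k * b 0 k.

(* The line through o with direction d (a genuine line only when d != 0). *)
Definition on_line (R : realType) (o d a : 'rV[R]_3) : Prop :=
  exists t : R, a = o + t *: d.

(* A point (t, s) of R x C is encoded as the row (t, Re s, Im s). *)
Definition hopf (R : realType) (z w : R[i]) : 'rV[R]_3 :=
  \row_k [:: (Normc.normc z ^+ 2 - Normc.normc w ^+ 2) / 2;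
             complex.Re (z * w^*); complex.Im (z * w^*)]`_k.

(* (z, w) are homogeneous coordinates of the point of CP^1 attached to the
   direction of a: some nonzero multiple of (z, w) is in the Hopf fiber of a.
   For a != 0 this determines (z, w) up to a nonzero scalar, and (z, w) != 0. *)
Definition cp1_coords (R : realType) (z w : R[i]) (a : 'rV[R]_3) : Prop :=
  exists2 k : R[i], k != 0 & hopf (k * z) (k * w) = a.

(* 'X_ord0 and 'X_ord_max are the two variables x and y. *)
Definition linear_form (R : realType) (z w : R[i]) : {mpoly R[i][2]} :=
  z *: 'X_ord0 + w *: 'X_ord_max.

Definition assoc_poly (R : realType) (N : nat) (u v : 'I_N -> 'I_N -> R[i])
    (i : 'I_N) : {mpoly R[i][2]} :=
  \prod_(j < N | j != i) linear_form (u i j) (v i j).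

Definition lin_indep (K : fieldType) (V : lmodType K) (N : nat)
    (p : 'I_N -> V) : Prop :=
  forall a : 'I_N -> K, \sum_i a i *: p i = 0 -> forall i, a i = 0.

(* The y j are, in some order, the vertices of a regular n-gon with center c,
   inscribed in the circle of radius |e| = |f| of the plane c + <e, f>.
   For n > 1 the center is the centroid of the vertices
   (regular_polygon_centroid).  For n = 1 there is a single vertex c + e, which
   is different from c; for n = 2 the vertices are c + e and c - e. *)
Definition regular_polygon (R : realType) (n : nat) (c e f : 'rV[R]_3)
    (y : 'I_n -> 'rV[R]_3) : Prop :=
  [/\ e != 0, dot e e = dot f f, dot e f = 0 &
      exists s : 'S_n, forall j : 'I_n,
        y j = c + cos (2 * pi * (s j)%:R / n%:R) *: e
                + sin (2 * pi * (s j)%:R / n%:R) *: f].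

Lemma sum_cos_sin (R : realType) (n : nat) : (1 < n)%N ->
  \sum_(j < n) cos (2 * pi * j%:R / n%:R) = 0 :> R /\
  \sum_(j < n) sin (2 * pi * j%:R / n%:R) = 0 :> R.
Proof.
move=> n1; have n0 : n%:R != 0 :> R by rewrite pnatr_eq0 -lt0n ltnW.
pose t : R := 2 * pi / n%:R; pose z : R[i] := cos t +i* sin t.
have zX k : z ^+ k = cos (2 * pi * k%:R / n%:R) +i* sin (2 * pi * k%:R / n%:R).
  elim: k => [|k IH]; first by rewrite !(mulr0, mul0r) cos0 sin0.
  have -> : 2 * pi * k.+1%:R / n%:R = t + 2 * pi * k%:R / n%:R :> R.
    by rewrite /t -(addn1 k) (natrD _ k) (mulrDr (2 * pi)) mulr1 mulrDl addrC.
  rewrite exprS IH cosD sinD; apply/eqP; rewrite eq_complex /= eqxx /=.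
  by rewrite addrC.
have zn : z ^+ n = 1.
  by rewrite zX mulfK // mulr_natl cos2pi sin2pi.
have z1 : z != 1.
  apply/eqP => -[ct _]; have t2 : t = (t / 2) *+ 2.
    by rewrite -mulr_natr divfK // pnatr_eq0.
  have th : t / 2 = pi / n%:R.
    by rewrite /t mulrC !mulrA mulVf ?mul1r // pnatr_eq0.
  have s0 : 0 < sin (t / 2).
    rewrite sin_gt0_pi // th divr_gt0 ?pi_gt0 ?ltr0n ?(ltnW n1) //=.
    by rewrite ltr_pdivrMr ?ltr0n ?(ltnW n1) // ltr_pMr ?pi_gt0 // ltr1n.
  have c2 : cos (t / 2) ^+ 2 = 1.
    move: ct; rewrite {1}t2 cos_mulr2n => /eqP.
    by rewrite subr_eq -[1 + 1]/(1 *+ 2) eqrMn2r => /eqP.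
  by have := exprn_gt0 2 s0; rewrite sin2cos2 c2 subrr ltxx.
have S0 : \sum_(j < n) z ^+ j = 0.
  apply: (mulfI (x := z - 1)); first by rewrite subr_eq0.
  by rewrite -subrX1 zn subrr mulr0.
have E : \sum_(j < n) z ^+ j =
  (\sum_(j < n) cos (2 * pi * j%:R / n%:R)) +i*
  (\sum_(j < n) sin (2 * pi * j%:R / n%:R)).
  elim/big_rec3: _ => [|j a b c _ ->] //.
  by rewrite zX.
by move: S0; rewrite E => -[-> ->].
Qed.

Lemma regular_polygon_centroid (R : realType) (n : nat) (c e f : 'rV[R]_3)
    (y : 'I_n -> 'rV[R]_3) :
  (1 < n)%N -> regular_polygon c e f y -> n%:R^-1 *: \sum_j y j = c.
Proof.
move=> n1 [_ _ _ [s ys]].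
have [C S] := sum_cos_sin R n1.
have -> : \sum_j y j = \sum_(j < n)
    (c + cos (2 * pi * j%:R / n%:R) *: e + sin (2 * pi * j%:R / n%:R) *: f).
  by rewrite [RHS](reindex_inj (@perm_inj _ s)); apply: eq_bigr => j _; apply: ys.
rewrite !big_split /= -!scaler_suml C S !scale0r !addr0 sumr_const card_ord.
by rewrite -scaler_nat scalerA mulVf ?scale1r // pnatr_eq0 -lt0n ltnW.
Qed.

(* Main.v *)
Require Import Defs.
From HB Require Import structures.
From mathcomp Require Import all_boot all_order all_algebra all_fingroup.
From mathcomp Require Import complex mpoly.
From mathcomp Require Import reals trigo.
From mathcomp Require Import ring zify.

Set Implicit Arguments.
Unset Strict Implicit.
Unset Printing Implicit Defensive.

Import Order.TTheory GRing.Theory Num.Theory.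
Local Open Scope ring_scope.

(** A vector a of R^3 acts on C^2 by the traceless Hermitian matrix [pauli a],
    and the pairs (z, w) over the direction of a under the Hopf map are the
    eigenvectors of [pauli a] for its positive eigenvalue ([hopf_eigen]).
    These matrices depend linearly on a and satisfy the Clifford relations, so
    the orthogonal frame made of the axis d and of the vectors e, f spanning
    the plane of the polygon is put in a standard form by a change of basis of
    C^2 ([clifford_frame]).  A change of basis of C^2 is a linear change of the
    variables x, y, which preserves linear independence; it takes the place of
    a rotation of R^3 bringing the axis to R x 0.

    After this change and after setting one of the variables to 1 (all the
    associated polynomials have the same degree), the associated polynomials
    become, up to nonzero scalars, the following polynomials in one variable
    X, where w is a primitive n-th root of unity:
    - 'X^k * (1 - nu 'X^n), with nu > 0, for the point of the axis that has
      exactly k points of the axis above it, so that k takes each value in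
      0, ..., m-1 once;
    - Q(w^j X) for the j-th vertex, where Q is the product of the factors
      1 + lam_i X, with lam_i > 0, that come from the points of the axis, and
      of the factors 1 + eta_l X for 0 < l < n, with
      eta_l = (1 - w^l) / |1 - w^l|, that come from the other vertices.

    The coefficients of Q are positive ([vertex_poly_gt0]): eta_l and
    eta_(n-l) are conjugate numbers of modulus 1 with sum |1 - w^l|, so their
    factors multiply to 1 + |1 - w^l| X + X^2.

    Independence follows from this positivity ([dihedral_independence]).  Given
    a relation with coefficients A_k on the first family and b_j on the second,
    put beta_k = \sum_j b_j w^(jk), which has period n in k.  The coefficient
    of X^k in the relation is A_k - nu_(k-n) A_(k-n) + Q_k beta_k = 0, where
    A_k = 0 outside 0, ..., m-1.  By induction on k, A_k = - gamma_k beta_k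
    with gamma_k = Q_k + nu_(k-n) gamma_(k-n) > 0.  Since A_k = 0 for
    m <= k < m + n, beta vanishes on a full period; the b_j, of which beta is
    the discrete Fourier transform, then vanish, and so do the A_k. *)

(** * Polynomials with positive coefficients *)

(** Stopping at the size of p makes the property multiplicative: each
    coefficient of a product up to its degree is a sum of nonnegative terms,
    of which at least one is positive. *)
Definition pos_coefs (C : numDomainType) (p : {poly C}) : Prop :=
  forall k, (k < size p)%N -> 0 < p`_k.

Lemma pos_coefs_ge0 (C : numDomainType) (p : {poly C}) k :
  pos_coefs p -> 0 <= p`_k.
Proof.
move=> p0; have [/p0/ltW //|pk] := ltnP k (size p).
by rewrite nth_default.
Qed.

Lemma pos_coefsM (C : numDomainType) (p q : {poly C}) :
  pos_coefs p -> pos_coefs q -> pos_coefs (p * q).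
Proof.
move=> p0 q0 k.
have [->|pn0] := eqVneq p 0; first by rewrite mul0r size_poly0.
have [->|qn0] := eqVneq q 0; first by rewrite mulr0 size_poly0.
have sp : (0 < size p)%N by rewrite size_poly_gt0.
have sq : (0 < size q)%N by rewrite size_poly_gt0.
move=> kpq; have {}kpq : (k < (size p + size q).-1)%N by rewrite -size_mul.
rewrite coefM.
(* The term of index min(k, deg p) of the convolution is positive. *)
have jk : (minn k (size p).-1 < k.+1)%N by rewrite ltnS geq_minl.
rewrite (bigD1 (Ordinal jk)) //= ltr_pwDl //.
  apply: mulr_gt0; [apply: p0 | apply: q0] => /=; move: sp sq kpq;
    by move: (size p) (size q) => a b; lia.
by apply: sumr_ge0 => i _; rewrite mulr_ge0 ?pos_coefs_ge0.
Qed.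

Lemma pos_coefs1 (C : numDomainType) : pos_coefs (1 : {poly C}).
Proof. by move=> [|k]; rewrite size_poly1 coef1 ?ltr01. Qed.

Lemma pos_coefs_linear (C : numDomainType) (a : C) :
  0 < a -> pos_coefs (1 + a *: 'X).
Proof.
move=> a0 k ks; have : (k < 2)%N.
  apply: leq_trans ks _; apply: leq_trans (size_polyD _ _) _.
  rewrite geq_max size_poly1 /=.
  by apply: leq_trans (size_scale_leq _ _) _; rewrite size_polyX.
case: k {ks} => [|[|//]] _; rewrite coefD coef1 coefZ coefX /=.
  by rewrite mulr0 addr0 ltr01.
by rewrite mulr1 add0r.
Qed.

Lemma pos_coefs_quadratic (C : numDomainType) (a : C) :
  0 < a -> pos_coefs (1 + a *: 'X + 'X^2).
Proof.
move=> a0 k ks; have : (k < 3)%N.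
  apply: leq_trans ks _; apply: leq_trans (size_polyD _ _) _.
  rewrite geq_max size_polyXn leqnn andbT.
  apply: leq_trans (size_polyD _ _) _; rewrite geq_max size_poly1 /=.
  by apply: leq_trans (size_scale_leq _ _) _; rewrite size_polyX.
by case: k {ks} => [|[|[|//]]] _;
  rewrite !coefD coef1 coefZ coefX coefXn /= ?mulr0 ?mulr1 ?addr0 ?add0r ?ltr01.
Qed.

(** Grouping the factors of indices l and n - l, from the ends of the range
    towards its middle, leaves at most the factor of index n / 2 alone. *)
Lemma pos_coefs_prod_sym (C : numDomainType) (n : nat) (g : nat -> {poly C}) :
  (forall l, (0 < l < n)%N -> pos_coefs (g l * g (n - l)%N)) ->
  (forall l, (0 < l < n)%N -> l.*2 = n -> pos_coefs (g l)) ->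
  pos_coefs (\prod_(1 <= l < n) g l).
Proof.
move=> gpair gmid.
have step k : forall a, (0 < a)%N -> (a + (a + k) = n.+1)%N ->
    pos_coefs (\prod_(a <= l < a + k) g l).
  have [N] := ubnP k; elim: N k => // N IH [|[|k]] kN a a0 an.
  - by rewrite addn0 big_geq //; apply: pos_coefs1.
  - by rewrite addn1 big_nat1; apply: gmid; lia.
  rewrite big_ltn; last by lia.
  rewrite !addnS big_nat_recr /=; last by lia.
  have -> : (a + k).+1 = (n - a)%N by lia.
  rewrite mulrCA mulrC; apply: pos_coefsM; first by apply: gpair; lia.
  have -> : (n - a = a.+1 + k)%N by lia.
  by apply: IH; lia.
case: n gpair gmid step => [|n] gpair gmid step.
  by rewrite big_geq //; apply: pos_coefs1.
by have := step n 1%N isT; rewrite add1n; apply; lia.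
Qed.

Lemma linear_polyM (C : comNzRingType) (a b : C) :
  (1 + a *: 'X) * (1 + b *: 'X) = 1 + (a + b) *: 'X + (a * b) *: 'X^2.
Proof. by rewrite -!mul_polyC polyCD polyCM; ring. Qed.

(** * Primitive roots of unity *)

Lemma prim_expr_neq0 (C : fieldType) (n : nat) (w : C) k :
  n.-primitive_root w -> w ^+ k != 0.
Proof.
move=> wP; rewrite expf_neq0 // (prim_root_eq0 wP) -lt0n.
exact: prim_order_gt0 wP.
Qed.

Lemma norm_prim_expr (C : numClosedFieldType) (n : nat) (w : C) k :
  n.-primitive_root w -> `|w ^+ k| = 1.
Proof.
move=> wP; rewrite normrX; suff -> : `|w| = 1 by rewrite expr1n.
apply/eqP; rewrite -(@pexpr_eq1 _ _ n) ?(prim_order_gt0 wP) //.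
by rewrite -normrX (prim_expr_order wP) normr1.
Qed.

Lemma conj_prim_expr (C : numClosedFieldType) (n : nat) (w : C) k :
  n.-primitive_root w -> (w ^+ k)^* = (w ^+ k)^-1.
Proof.
by move=> wP; rewrite invC_norm (norm_prim_expr k wP) expr1n invr1 mul1r.
Qed.

Lemma conj_prim_exprB (C : numClosedFieldType) (n : nat) (w : C) k l :
  n.-primitive_root w -> (w ^+ k - w ^+ l)^* = (w ^+ k)^-1 - (w ^+ l)^-1.
Proof. by move=> wP; rewrite rmorphB /= !(conj_prim_expr _ wP). Qed.

(** The unit vector along the chord from w ^+ l to 1.  It is the ratio of
    homogeneous coordinates attached to the direction between two vertices,
    as seen from the vertex 1. *)
Definition chord_dir (C : numClosedFieldType) (w : C) (l : nat) : C :=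
  (1 - w ^+ l) / `|1 - w ^+ l|.

Lemma chord_neq0 (C : numClosedFieldType) (n : nat) (w : C) l :
  n.-primitive_root w -> (0 < l < n)%N -> 1 - w ^+ l != 0.
Proof.
move=> wP ln; rewrite subr_eq0 eq_sym -(prim_order_dvd wP).
by apply/negP => /dvdn_leq; lia.
Qed.

(** The factors of indices l and n - l have conjugate coefficients of norm
    1, whose sum is |1 - w ^+ l|, because
    (1 - w ^+ l) + (1 - w ^+ (n - l)) = |1 - w ^+ l| ^+ 2; their product is
    therefore 1 + |1 - w ^+ l| X + X^2. *)
Lemma pos_coefs_prod_chords (C : numClosedFieldType) (n : nat) (w : C) :
  n.-primitive_root w ->
  pos_coefs (\prod_(1 <= l < n) (1 + chord_dir w l *: 'X)).
Proof.
move=> wP; have w0 l : w ^+ l != 0 := prim_expr_neq0 l wP.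
have sqr_norm l : `|1 - w ^+ l| ^+ 2 = (1 - w ^+ l) + (1 - (w ^+ l)^*).
  by rewrite normCK rmorphB rmorph1 /= (conj_prim_expr _ wP); field.
have norm0 l : (0 < l < n)%N -> 0 < `|1 - w ^+ l|.
  by move=> ln; rewrite normr_gt0 (chord_neq0 wP).
apply: pos_coefs_prod_sym => l ln.
  have ew : w ^+ (n - l) = (w ^+ l)^*.
    rewrite (conj_prim_expr _ wP); apply: (mulIf (w0 l)).
    by rewrite -exprD subnK ?(prim_expr_order wP) ?mulVf //; lia.
  have en : `|1 - w ^+ (n - l)| = `|1 - w ^+ l|.
    by rewrite ew -norm_conjC rmorphB rmorph1 /= conjCK.
  have nz : `|1 - w ^+ l| != 0 by rewrite gt_eqF ?norm0.
  rewrite linear_polyM.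
  have -> : chord_dir w l * chord_dir w (n - l) = 1.
    rewrite /chord_dir en ew mulf_div -expr2 normCK rmorphB rmorph1 /=.
    have := expf_neq0 2 nz.
    by rewrite normCK rmorphB rmorph1 /=; apply: divff.
  have -> : chord_dir w l + chord_dir w (n - l) = `|1 - w ^+ l|.
    by rewrite /chord_dir en ew -mulrDl -sqr_norm expr2 mulfK.
  by rewrite scale1r; apply: pos_coefs_quadratic; apply: norm0.
(* If l = n - l, then w ^+ l is real, and 1 - w ^+ l is half of the square
   of its norm. *)
move=> l2; apply: pos_coefs_linear.
have ew : (w ^+ l)^* = w ^+ l.
  rewrite (conj_prim_expr _ wP); apply: (mulIf (w0 l)).
  by rewrite -exprD addnn l2 (prim_expr_order wP) mulVf.
have := sqr_norm l; rewrite ew /chord_dir => sn.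
have -> : 1 - w ^+ l = `|1 - w ^+ l| ^+ 2 / 2 by rewrite sn; field.
rewrite normf_div normrX normr_id normr_nat.
by rewrite divr_gt0 // ?divr_gt0 ?exprn_gt0 ?norm0.
Qed.

(** It is the factorization of 'X^n - 1 over the powers of w^-1, rescaled:
    1 - w ^+ k 'X is a multiple of 'X - w ^- k, and the constant terms fix
    the product of the scalars. *)
Lemma prod_one_sub_prim (C : numClosedFieldType) (n : nat) (w a : C) :
  n.-primitive_root w ->
  \prod_(k < n) (1 - (a * w ^+ k) *: 'X) = 1 - a ^+ n *: 'X^n.
Proof.
move=> wP; have n0 := prim_order_gt0 wP.
have w0 k : w ^+ k != 0 := prim_expr_neq0 k wP.
have base : \prod_(k < n) (1 - w ^+ k *: 'X) = 1 - 'X^n :> {poly C}.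
  have wV : n.-primitive_root w^-1.
    by rewrite -(expr1 w) -(conj_prim_expr _ wP) expr1 fmorph_primitive_root.
  have E : \prod_(k < n) (1 - w ^+ k *: 'X) =
      (\prod_(k < n) (- w ^+ k)) *: ('X^n - 1) :> {poly C}.
    rewrite -(factor_Xn_sub_1 wV) big_mkord -scaler_prod; apply: eq_bigr => k _.
    by rewrite exprVn scalerBr !scaleNr -!mul_polyC -polyCM divff // addrC opprK.
  have := congr1 (fun p : {poly C} => p.[0]) E.
  rewrite horner_prod big1 => [|k _].
    rewrite hornerZ !hornerE expr0n gtn_eqF //= sub0r mulrN1 => /eqP.
    by rewrite E -eqr_oppLR => /eqP <-; rewrite scaleN1r opprB.
  by rewrite !hornerE ?mulr0 ?subr0.
have := congr1 (fun p : {poly C} => p \Po (a *: 'X)) base.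
rewrite rmorph_prod /= comp_polyB rmorphXn /= comp_polyX rmorph1 exprZn => <-.
apply: eq_bigr => k _.
by rewrite comp_polyB rmorph1 /= comp_polyZ comp_polyX scalerA [a * _]mulrC.
Qed.

Lemma coef_comp_scaleX (C : comNzRingType) (p : {poly C}) (z : C) k :
  (p \Po (z *: 'X))`_k = p`_k * z ^+ k.
Proof.
have -> : p \Po (z *: 'X) = \poly_(i < size p) (p`_i * z ^+ i).
  rewrite comp_polyE poly_def; apply: eq_bigr => i _.
  by rewrite exprZn scalerA.
rewrite coef_poly; case: ltnP => // pk.
by rewrite nth_default // mul0r.
Qed.

(** * Linear independence in a normal form *)

(** The extension by 0 lets the index k - n run outside the range of the
    family in the recurrences on coefficients below. *)
Definition ext0 (C : nmodType) (n : nat) (f : 'I_n -> C) (k : nat) : C :=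
  if insub k is Some i then f i else 0.

Lemma ext0E (C : nmodType) n (f : 'I_n -> C) (i : 'I_n) : ext0 f i = f i.
Proof. by rewrite /ext0 valK. Qed.

(** The b_j are the coefficients of a polynomial of degree less than n, which
    would vanish at the n distinct powers of w with exponents in a full
    period. *)
Lemma prim_root_dft_eq0 (C : fieldType) (n : nat) (w : C) (b : 'I_n -> C) m :
  n.-primitive_root w ->
  (forall k, (m <= k < m + n)%N -> \sum_j b j * (w ^+ j) ^+ k = 0) ->
  forall j, b j = 0.
Proof.
move=> wP b0 j.
pose p := \poly_(i < n) ext0 b i.
suff p0 : p = 0.
  have := congr1 (fun q : {poly C} => q`_j) p0.
  by rewrite coef_poly ltn_ord ext0E coef0.
apply/eqP; apply: contraT => pn0.
pose rs := [seq w ^+ k | k <- iota m n].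
have rp : all (root p) rs.
  apply/allP => z /mapP[k]; rewrite mem_iota => km ->.
  apply/rootP; rewrite horner_poly -[RHS](b0 k km); apply: eq_bigr => i _.
  by rewrite ext0E -!exprM mulnC.
have urs : uniq rs.
  rewrite map_inj_in_uniq ?iota_uniq // => k l; rewrite !mem_iota => km lm.
  move=> /eqP; rewrite (eq_prim_root_expr wP).
  wlog lk : k l km lm / (l <= k)%N.
    move=> IH; have [/IH|/ltnW/IH + /eqP] := leqP l k; first exact.
    by move=> E kl; apply/esym/E => //; apply/eqP.
  rewrite eqn_mod_dvd // => /dvdnP[[|q] kl]; lia.
have := max_poly_roots pn0 rp urs.
by rewrite size_map size_iota ltnNge size_poly.
Qed.

(** The positivity argument.  The only interaction between coefficients is
    between the degrees k and k - n, and there all the signs agree: the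
    relation forces A_k to be a negative multiple of
    beta k = \sum_j b_j w ^+ (j k) for every k < m + n.  Beyond m these A_k are 0,
    which kills a full period of beta. *)
Lemma dihedral_independence (C : numFieldType) (m n : nat) (w : C)
    (nu A : 'I_m -> C) (Q : {poly C}) (b : 'I_n -> C) :
  n.-primitive_root w -> (forall k, 0 < nu k) ->
  (forall k, (k < m + n)%N -> 0 < Q`_k) ->
  \sum_k A k *: ('X^k * (1 - nu k *: 'X^n))
    + \sum_j b j *: (Q \Po (w ^+ j *: 'X)) = 0 ->
  (forall k, A k = 0) /\ (forall j, b j = 0).
Proof.
move=> wP nu0 Q0 rel.
pose beta k := \sum_j b j * (w ^+ j) ^+ k.
have betaD k : beta (k + n)%N = beta k.
  apply: eq_bigr => j _; rewrite -!exprM mulnDr exprD [(j * n)%N]mulnC.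
  by rewrite [w ^+ (n * j)]exprM (prim_expr_order wP) expr1n mulr1.
pose P := \poly_(k < m) ext0 A k.
pose P' := \poly_(k < m) (ext0 nu k * ext0 A k).
have coefs k : P`_k - (if (k < n)%N then 0 else P'`_(k - n)) + Q`_k * beta k = 0.
  have E : \sum_(i < m) A i *: ('X^i * (1 - nu i *: 'X^n)) = P - P' * 'X^n.
    rewrite /P /P' !poly_def mulr_suml -sumrB; apply: eq_bigr => i _.
    rewrite !ext0E mulrBr mulr1 scalerBr -scalerAr -scalerAl scalerA.
    by rewrite [A i * _]mulrC.
  have := congr1 (fun p : {poly C} => p`_k) rel.
  rewrite E coef0 coefD coefB coefMXn coef_sum => rk; rewrite -[RHS]rk.
  congr (_ + _); rewrite /beta mulr_sumr; apply: eq_bigr => j _.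
  by rewrite coefZ coef_comp_scaleX mulrCA.
(* The factor g satisfies g_k = Q_k + nu_(k-n) g_(k-n), a sum of positive
   terms. *)
have neg k : (k < m + n)%N -> exists2 g : C, 0 < g & P`_k = - (g * beta k).
  have [N] := ubnP k; elim: N k => // N IH k kN kmn.
  have := coefs k; case: ltnP => kn.
    rewrite subr0 => /eqP; rewrite addr_eq0 => /eqP ->.
    by exists Q`_k; rewrite ?Q0.
  have km : (k - n < m)%N by lia.
  have [||g g0 Pg] := IH (k - n)%N; try (have := prim_order_gt0 wP; lia).
  pose i := Ordinal km.
  have Pi : P`_(k - n) = A i by rewrite coef_poly km (ext0E A i).
  rewrite [P'`__]coef_poly km (ext0E nu i) (ext0E A i) -Pi Pg => E.
  exists (Q`_k + nu i * g); first by rewrite addr_gt0 ?mulr_gt0 ?Q0 ?nu0.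
  have bk : beta k = beta (k - n)%N by rewrite -(betaD (k - n)%N) subnK.
  move/eqP: E; rewrite -addrA addr_eq0 => /eqP ->; rewrite bk.
  by ring.
have beta0 k : (m <= k < m + n)%N -> beta k = 0.
  move=> /andP[mk kmn]; have [g g0] := neg k kmn.
  rewrite coef_poly ltnNge mk /= => /eqP.
  by rewrite eq_sym oppr_eq0 mulf_eq0 gt_eqF //= => /eqP.
have b0 := prim_root_dft_eq0 wP beta0; split=> // k.
have [|g _] := neg k; first by have := ltn_ord k; lia.
rewrite coef_poly ltn_ord ext0E => ->.
by rewrite /beta big1 ?mulr0 ?oppr0 // => j _; rewrite b0 mul0r.
Qed.

(** * The Hopf map and the Clifford relations *)

Local Open Scope complex_scope.

(** This is the sum of the coordinates of a times the Pauli matrices, in the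
    coordinates (t, Re s, Im s) of R x C.  It acts on row vectors from the
    right, hence it is the transpose of [[t, s], [s^*, -t]]. *)
Definition pauli (R : realType) (a : 'rV[R]_3) : 'M[R[i]]_2 :=
  \matrix_(i, j) (if i == 0 then [:: (a 0 0)%:C; a 0 1 -i* a 0 2%:R]`_j
                  else [:: a 0 1 +i* a 0 2%:R; - (a 0 0)%:C]`_j).

Definition spinor (R : realType) (z w : R[i]) : 'rV[R[i]]_2 :=
  \row_j [:: z; w]`_j.

Lemma pauliD (R : realType) (a b : 'rV[R]_3) :
  pauli (a + b) = pauli a + pauli b.
Proof.
apply/matrixP => -[[|[|//]] i2] [[|[|//]] j2]; rewrite !mxE /=;
  apply/eqP; rewrite eq_complex /=; apply/andP; split; apply/eqP; ring.
Qed.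

Lemma pauliZ (R : realType) (k : R) (a : 'rV[R]_3) :
  pauli (k *: a) = k%:C *: pauli a.
Proof.
apply/matrixP => -[[|[|//]] i2] [[|[|//]] j2]; rewrite !mxE /=;
  apply/eqP; rewrite eq_complex /=; apply/andP; split; apply/eqP; ring.
Qed.

Lemma pauli_anticomm (R : realType) (a b : 'rV[R]_3) :
  pauli a *m pauli b + pauli b *m pauli a = (2 * dot a b)%:C%:M.
Proof.
have o (v : 'rV[R]_3) : [/\ v 0 ord0 = v 0 0, v 0 (lift ord0 ord0) = v 0 1 &
    v 0 (lift ord0 (lift ord0 ord0)) = v 0 2%:R].
  by split; congr (v 0 _); apply: val_inj.
have [a0 a1 a2] := o a; have [b0 b1 b2] := o b.
apply/matrixP => -[[|[|//]] i2] [[|[|//]] j2];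
  rewrite /dot !mxE !big_ord_recl !big_ord0 !mxE /= ?a0 ?a1 ?a2 ?b0 ?b1 ?b2;
  by apply/eqP; rewrite eq_complex /=; apply/andP; split; apply/eqP; ring.
Qed.

(** If a = h(Z, W), the eigenvalue is rho = (|Z|^2 + |W|^2) / 2, the norm of
    a; the relation is linear in (Z, W), hence insensitive to the scalar that
    relates (Z, W) to (z, w). *)
Lemma hopf_eigen (R : realType) (z w : R[i]) (a : 'rV[R]_3) :
  cp1_coords z w a ->
  exists2 rho : R[i], 0 <= rho & spinor z w *m pauli a = rho *: spinor z w.
Proof.
move=> [k kn0 <-].
suff [rho rho0 rhoE] : exists2 rho : R[i], 0 <= rho &
    spinor (k * z) (k * w) *m pauli (hopf (k * z) (k * w)) =
    rho *: spinor (k * z) (k * w).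
  exists rho => //.
  have kS : spinor (k * z) (k * w) = k *: spinor z w.
    by apply/rowP => -[[|[|//]] j2]; rewrite !mxE.
  move: rhoE; rewrite kS -scalemxAl scalerA [rho * k]mulrC -scalerA.
  by move/(scalerI kn0).
move: (k * z) (k * w) => {k kn0 z w}[z1 z2] [w1 w2].
have nsq (x y : R) : Normc.normc (x +i* y) ^+ 2 = x ^+ 2 + y ^+ 2.
  by rewrite /= sqr_sqrtr // addr_ge0 ?sqr_ge0.
exists ((z1 ^+ 2 + z2 ^+ 2 + w1 ^+ 2 + w2 ^+ 2) / 2)%:C.
  by rewrite ler0c divr_ge0 ?addr_ge0 ?sqr_ge0.
apply/rowP => -[[|[|//]] j2];
  rewrite !mxE !big_ord_recl big_ord0 !mxE /= -/(Normc.normc _) !nsq;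
  by apply/eqP; rewrite eq_complex /=; apply/andP; split; apply/eqP; field.
Qed.

Lemma spinor_neq0 (R : realType) (z w : R[i]) (a : 'rV[R]_3) :
  cp1_coords z w a -> a != 0 -> spinor z w != 0.
Proof.
move=> [k _ <-]; apply: contraNneq => zw0.
have [z0 w0] : z = 0 /\ w = 0.
  by split; [have /rowP/(_ 0) := zw0 | have /rowP/(_ 1) := zw0]; rewrite !mxE.
apply/eqP/rowP => -[[|[|[|//]]] j3]; rewrite !mxE z0 w0 mulr0 /=.
- by rewrite subrr mul0r.
- by rewrite ?mulr0 ?subrr ?mul0r ?oppr0 ?addr0.
by rewrite ?mulr0 ?mul0r ?subrr ?oppr0 ?addr0.
Qed.


(** Three anticommuting involutions of K^2 have a standard form.  Take p fixed
    by D; then q = p E is an eigenvector of D for -1, so p and q form a basis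
    (the rows of g).  As F E commutes with D, it preserves the line of p, which
    gives p F = kappa q and q F = - kappa p; squaring, kappa ^+ 2 = -1.  The
    two signs of kappa correspond to the two orientations of the frame.
    The conclusion is the eigenvector equation
    for t D + x E + y F written in the coordinates of the basis p, q. *)
Lemma clifford_frame (K : fieldType) (D E F : 'M[K]_2) :
  2%:R != 0 :> K -> D *m D = 1%:M -> E *m E = 1%:M -> F *m F = 1%:M ->
  D *m E = - (E *m D) -> D *m F = - (F *m D) -> E *m F = - (F *m E) ->
  exists (g : 'M[K]_2) (kappa : K), [/\ g \in unitmx, kappa ^+ 2 = -1 &
    forall (phi : 'rV[K]_2) t x y rho,
      phi *m g *m (t *: D + x *: E + y *: F) = rho *: (phi *m g) ->
      t * phi 0 0 + (x - kappa * y) * phi 0 1 = rho * phi 0 0 /\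
      (x + kappa * y) * phi 0 0 - t * phi 0 1 = rho * phi 0 1].
Proof.
move=> n2 DD EE FF DE DF EF.
have addvv (v : 'rV[K]_2) : v = - v -> v = 0.
  move/eqP; rewrite -addr_eq0 -mulr2n -scaler_nat scaler_eq0 (negPf n2) /=.
  by move/eqP.
have [p pn0 pD] : exists2 p : 'rV[K]_2, p != 0 & p *m D = p.
  have : D + 1%:M != 0.
    apply/negP; rewrite addr_eq0 => /eqP D1.
    have EN : E = - E.
      by move: DE; rewrite D1 mulNmx mulmxN mul1mx mulmx1 opprK => {1}<-.
    have E0 : E = 0.
      by apply/row_matrixP => i; rewrite row0; apply: addvv; rewrite {1}EN linearN.
    have /matrixP/(_ 0 0) := EE; rewrite E0 mul0mx !mxE => /eqP.
    by rewrite eq_sym oner_eq0.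
  case/rowV0Pn => p /submxP[q ->] pn0; exists (q *m (D + 1%:M)) => //.
  by rewrite -mulmxA mulmxDl mul1mx DD addrC.
have [q qdef] : {q : 'rV[K]_2 | q = p *m E} by exists (p *m E).
have qE : q *m E = p by rewrite qdef -mulmxA EE mulmx1.
have qD : q *m D = - q.
  by rewrite qdef -mulmxA -[E *m D]opprK -DE mulmxN mulmxA pD.
have qn0 : q != 0 by apply: contraNneq pn0 => q0; rewrite -qE q0 mul0mx.
have indep a b : a *: p + b *: q = 0 -> a = 0 /\ b = 0.
  move=> ab; have := congr1 (mulmxr D) ab; rewrite /= mul0mx mulmxDl.
  rewrite -!scalemxAl pD qD scalerN => ab'.
  have ap : a *: p = 0.
    apply: addvv; apply/eqP; rewrite -addr_eq0.
    rewrite -[X in X + _](addrK (b *: q)) ab sub0r addrC.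
    by rewrite ab'.
  have bq : b *: q = 0 by rewrite -ab ap add0r.
  move/eqP: ap; move/eqP: bq; rewrite !scaler_eq0 (negPf pn0) (negPf qn0).
  by rewrite !orbF => /eqP -> /eqP ->.
pose g : 'M[K]_2 := \matrix_(i, j) (if i == 0 then p 0 j else q 0 j).
have gE (phi : 'rV[K]_2) : phi *m g = phi 0 0 *: p + phi 0 1 *: q.
  apply/rowP => j; rewrite !mxE !big_ord_recl big_ord0 addr0 !mxE /=.
  by congr (_ + phi 0 _ * _); apply: val_inj.
have gU : g \in unitmx.
  rewrite unitmxE unitfE; apply/negP => /det0P[phi phin0].
  rewrite gE => /indep[p0 p1]; case/eqP: phin0; apply/rowP => j.
  rewrite mxE; case: j => [[|[|//]] j2];
    [rewrite -[RHS]p0 | rewrite -[RHS]p1]; by congr (phi 0 _); apply: val_inj.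
have [kappa pF] : exists kappa, p *m F = kappa *: q.
  pose r := p *m F *m E.
  have rD : r *m D = r.
    have FED : F *m E *m D = D *m F *m E.
      by rewrite -mulmxA -[E *m D]opprK -DE mulmxN mulmxA DF mulNmx.
    by rewrite /r -!mulmxA [F *m (E *m D)]mulmxA FED !mulmxA pD.
  pose phi := r *m invmx g; have phiE : phi *m g = r by rewrite mulmxKV.
  exists (phi 0 0).
  have q1 : phi 0 1 *: q = 0.
    apply: addvv; move: rD; rewrite -phiE gE mulmxDl -!scalemxAl pD qD scalerN.
    by move/addrI.
  have -> : p *m F = r *m E by rewrite /r -mulmxA EE mulmx1.
  by rewrite -phiE gE q1 addr0 -scalemxAl qdef.
have qF : q *m F = - kappa *: p.
  by rewrite qdef -mulmxA EF mulmxN mulmxA pF -scalemxAl qE scaleNr.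
exists g, kappa; split=> //.
  have := congr1 (mulmx p) FF.
  rewrite mulmxA pF -scalemxAl qF scalerA mulmx1 => e.
  have : (kappa * - kappa - 1) *: p + 0 *: q = 0.
    by rewrite scalerBl e scale1r subrr scale0r addr0.
  by case/indep => /eqP; rewrite subr_eq0 mulrN -expr2 eqr_oppLR => /eqP.
move=> phi t x y rho; rewrite gE; set a := phi 0 0; set b := phi 0 1 => H.
have : (t * a + (x - kappa * y) * b - rho * a) *: p +
       ((x + kappa * y) * a - t * b - rho * b) *: q = 0.
  move/eqP: H; rewrite -subr_eq0 => /eqP <-.
  rewrite mulmxDl -!scalemxAl !mulmxDr -!scalemxAr pD qD pF qF -qdef qE.
  by apply/rowP => j; rewrite !mxE; ring.
by case/indep => /eqP + /eqP; rewrite !subr_eq0 => /eqP -> /eqP ->.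
Qed.

(** * Coordinates adapted to the axis *)

(** If the rows of g are p and q, a linear form with coefficient vector
    alpha p + beta q is sent to beta - alpha X: the variables dual to p and q
    are replaced by - X and 1.  The minus sign gives the positive factors
    1 + lam X for the polynomials of the vertices. *)
Definition dehomog (K : fieldType) (g : 'M[K]_2) : {mpoly K[2]} -> {poly K} :=
  mmap (@polyC K) (fun i => (invmx g i 1)%:P - invmx g i 0 *: 'X).

HB.instance Definition _ (K : fieldType) (g : 'M[K]_2) :=
  GRing.RMorphism.copy (dehomog g) (mmap (@polyC K) _).

Lemma dehomogZ (K : fieldType) (g : 'M[K]_2) c p :
  dehomog g (c *: p) = c *: dehomog g p.
Proof. by rewrite /dehomog mmapZ mul_polyC. Qed.

Lemma dehomog_linear_form (R : realType) (g : 'M[R[i]]_2) (z w : R[i]) :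
  let phi := spinor z w *m invmx g in
  dehomog g (linear_form z w) = (phi 0 1)%:P - phi 0 0 *: 'X.
Proof.
rewrite /linear_form rmorphD /= !dehomogZ /dehomog !mmapX !mmap1U.
rewrite !mxE !big_ord_recl !big_ord0 !mxE /= !addr0.
have -> : lift ord0 ord0 = ord_max :> 'I_2 by apply: val_inj.
by rewrite -!mul_polyC !polyCD !polyCM; ring.
Qed.

Lemma dot_gt0 (R : realType) (a : 'rV[R]_3) : a != 0 -> 0 < dot a a.
Proof.
move=> an0; have sq k : 0 <= a 0 k * a 0 k by rewrite -expr2 sqr_ge0.
rewrite lt_neqAle sumr_ge0 // andbT eq_sym; apply: contraNneq an0 => a0.
apply/eqP/rowP => k; rewrite mxE; apply/eqP.
by have /psumr_eq0P/(_ k isT)/eqP := a0; rewrite mulf_eq0 orbb; apply.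
Qed.

(** Combines the eigenvector description of the Hopf fibers with the standard
    form of the Clifford relations for the normalized vectors of the frame;
    lend and lene are the lengths of d and of e, f. *)
Lemma adapted_frame (R : realType) (d e f : 'rV[R]_3) :
  d != 0 -> e != 0 -> dot e e = dot f f ->
  dot e f = 0 -> dot d e = 0 -> dot d f = 0 ->
  exists (g : 'M[R[i]]_2) (kappa : R[i]) (lend lene : R),
    [/\ kappa ^+ 2 = -1, 0 < lend, 0 < lene &
    forall z w (t x y : R) (a := t *: d + x *: e + y *: f),
      cp1_coords z w a -> a != 0 ->
      exists alpha beta rho : R[i],
      [/\ dehomog g (linear_form z w) = beta%:P - alpha *: 'X,
          (alpha != 0) || (beta != 0), 0 <= rho,
          (t * lend)%:C * alpha + lene%:C * (x%:C - kappa * y%:C) * beta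
            = rho * alpha &
          lene%:C * (x%:C + kappa * y%:C) * alpha - (t * lend)%:C * beta
            = rho * beta]].
Proof.
move=> dn0 en0 eef def ded dff.
pose ld := Num.sqrt (dot d d); pose le := Num.sqrt (dot e e).
have ld0 : 0 < ld by rewrite sqrtr_gt0 dot_gt0.
have le0 : 0 < le by rewrite sqrtr_gt0 dot_gt0.
have two : (2 : R[i]) != 0 by rewrite pnatr_eq0.
have unit_sq (v : 'rV[R]_3) l : 0 < l -> dot v v = l ^+ 2 ->
    pauli (l^-1 *: v) *m pauli (l^-1 *: v) = 1%:M.
  move=> l0 vl; rewrite -[LHS]scale1r.
  have half : (1 : R[i]) = 2^-1 + 2^-1 by field.
  rewrite {1}half scalerDl -scalerDr pauli_anticomm.
  have -> : dot (l^-1 *: v) (l^-1 *: v) = 1.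
    have -> : dot (l^-1 *: v) (l^-1 *: v) = l^-1 * l^-1 * dot v v.
      by rewrite /dot mulr_sumr; apply: eq_bigr => k _; rewrite !mxE; ring.
    by rewrite vl expr2 -mulrA mulKf ?mulVf ?gt_eqF.
  by rewrite mulr1 scale_scalar_mx rmorph_nat mulVf.
have orth_anti (v v' : 'rV[R]_3) l l' : dot v v' = 0 ->
    pauli (l *: v) *m pauli (l' *: v') = - (pauli (l' *: v') *m pauli (l *: v)).
  move=> vv; apply/eqP; rewrite -addr_eq0 pauli_anticomm.
  have -> : dot (l *: v) (l' *: v') = l * l' * dot v v'.
    by rewrite /dot mulr_sumr; apply: eq_bigr => k _; rewrite !mxE; ring.
  by rewrite vv !mulr0 raddf0.
have sqd : dot d d = ld ^+ 2 by rewrite sqr_sqrtr // ltW ?dot_gt0.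
have sqe : dot e e = le ^+ 2 by rewrite sqr_sqrtr // ltW ?dot_gt0.
have sqf : dot f f = le ^+ 2 by rewrite -eef.
have [g [kappa [gU k2 gE]]] := clifford_frame two (unit_sq _ _ ld0 sqd)
  (unit_sq _ _ le0 sqe) (unit_sq _ _ le0 sqf) (orth_anti _ _ _ _ ded)
  (orth_anti _ _ _ _ dff) (orth_anti _ _ _ _ def).
exists g, kappa, ld, le; split=> // z w t x y a zwa an0.
have [rho rho0 rhoE] := hopf_eigen zwa.
pose phi := spinor z w *m invmx g.
have phig : phi *m g = spinor z w by rewrite mulmxKV.
have phin0 : phi != 0.
  by apply: contraNneq (spinor_neq0 zwa an0) => phi0; rewrite -phig phi0 mul0mx.
have aE : pauli a = (t * ld)%:C *: pauli (ld^-1 *: d)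
    + (x * le)%:C *: pauli (le^-1 *: e) + (y * le)%:C *: pauli (le^-1 *: f).
  by rewrite -!pauliZ -!pauliD !scalerA !mulfK ?gt_eqF.
have [] := gE phi (t * ld)%:C (x * le)%:C (y * le)%:C rho.
  by rewrite phig -aE.
move=> e1 e2; exists (phi 0 0), (phi 0 1), rho; split=> //.
- exact: dehomog_linear_form.
- rewrite -negb_and; apply: contraNN phin0 => /andP[/eqP p0 /eqP p1].
  apply/eqP/rowP => -[[|[|//]] j2]; rewrite [RHS]mxE;
    [rewrite -[RHS]p0 | rewrite -[RHS]p1]; by congr (phi 0 _); apply: val_inj.
- by rewrite -e1 ![(_ * le)%:C]rmorphM /=; ring.
by rewrite -e2 ![(_ * le)%:C]rmorphM /=; ring.
Qed.

(** * The linear forms in adapted coordinates *)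

Local Close Scope complex_scope.

(** The eigenvector equation in adapted coordinates for a direction with
    height t along the axis and radial part s; s' is meant to be the conjugate
    of s. *)
Definition eigen_coords (C : numClosedFieldType) (t s s' rho alpha beta : C) :=
  [/\ (alpha != 0) || (beta != 0), 0 <= rho,
      t * alpha + s * beta = rho * alpha & s' * alpha - t * beta = rho * beta].

Lemma form_axial_pos (C : numClosedFieldType) (t rho alpha beta : C) :
  eigen_coords t 0 0 rho alpha beta -> 0 < t ->
  exists2 c : C, c != 0 & beta%:P - alpha *: 'X = c *: 'X.
Proof.
move=> [ab r0 _ e2] t0; have b0 : beta = 0.
  apply/eqP; move/eqP: e2; rewrite mul0r sub0r -subr_eq0 -opprD oppr_eq0 -mulrDl.
  by rewrite mulf_eq0 gt_eqF ?ltr_wpDr.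
exists (- alpha); last by rewrite b0 raddf0 sub0r scaleNr.
by move: ab; rewrite b0 eqxx orbF oppr_eq0.
Qed.

Lemma form_axial_neg (C : numClosedFieldType) (t rho alpha beta : C) :
  eigen_coords t 0 0 rho alpha beta -> t < 0 ->
  exists2 c : C, c != 0 & beta%:P - alpha *: 'X = c *: 1.
Proof.
move=> [ab r0 e1 _] t0; have a0 : alpha = 0.
  apply/eqP; move/eqP: e1; rewrite mul0r addr0 eq_sym -subr_eq0 -mulrBl.
  by rewrite mulf_eq0 gt_eqF // ltr_wpDl // oppr_gt0.
exists beta; last by rewrite a0 scale0r subr0 alg_polyC.
by move: ab; rewrite a0 eqxx.
Qed.

(** The length of a vector that is not on the axis exceeds its height. *)
Lemma oblique_gt0 (C : numClosedFieldType) (t q : C) :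
  t \is Num.real -> 0 < q -> 0 < sqrtC (t ^+ 2 + q) - t.
Proof.
move=> tR q0; have t2 : 0 <= t ^+ 2 by rewrite -realEsqr.
have tq : 0 <= t ^+ 2 + q by rewrite addr_ge0 // ltW.
rewrite subr_gt0 (le_lt_trans (real_ler_norm tR)) //.
rewrite -(@ltr_pXn2r _ 2) // ?nnegrE ?sqrtC_ge0 //.
by rewrite sqrtCK real_normK // ltrDl.
Qed.

(** The two equations give rho ^+ 2 = t ^+ 2 + s * s', which determines the
    eigenvalue, and then (rho - t) alpha = s beta determines alpha / beta. *)
Lemma form_oblique (C : numClosedFieldType) (t s s' rho alpha beta : C) :
  eigen_coords t s s' rho alpha beta -> t \is Num.real -> 0 < s * s' ->
  exists2 c : C, c != 0 &
    beta%:P - alpha *: 'X = c *: (1 - (s / (sqrtC (t ^+ 2 + s * s') - t)) *: 'X).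
Proof.
move=> [ab r0 e1 e2] tR ss.
have [sn0 sn0'] : s != 0 /\ s' != 0.
  by apply/andP; rewrite -negb_or -mulf_eq0 gt_eqF.
have e1' : (rho - t) * alpha = s * beta by rewrite mulrBl -e1; ring.
have e2' : (rho + t) * beta = s' * alpha by rewrite mulrDl -e2; ring.
have bn0 : beta != 0.
  apply/negP => /eqP b0; move: e2'; rewrite b0 mulr0 => /esym/eqP.
  rewrite mulf_eq0 (negPf sn0') /= => a0.
  by move: ab; rewrite b0 a0 eqxx.
have an0 : alpha != 0.
  apply/negP => /eqP a0; move: e1'; rewrite a0 mulr0 => /esym/eqP.
  by rewrite mulf_eq0 (negPf sn0) (negPf bn0).
have := oblique_gt0 tR ss; have -> : t ^+ 2 + s * s' = rho ^+ 2.
  apply: (mulIf an0).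
  have E : (rho + t) * ((rho - t) * alpha) = s * (s' * alpha).
    by rewrite e1' mulrCA e2'.
  by rewrite mulrDl -[s * s' * alpha]mulrA -E; ring.
rewrite sqrCK // => rt; exists beta => //.
rewrite scalerBr alg_polyC scalerA; congr (_ - _ *: _).
by apply: (mulfI (lt0r_neq0 rt)); rewrite e1'; field; rewrite lt0r_neq0.
Qed.


(** * From linear forms to associated polynomials *)

Lemma scaled_prod (K : fieldType) (I : finType) (P : pred I)
    (F G : I -> {poly K}) :
  (forall i, P i -> exists2 c : K, c != 0 & F i = c *: G i) ->
  exists2 c : K, c != 0 & \prod_(i | P i) F i = c *: \prod_(i | P i) G i.
Proof.
move=> FG.
apply: (big_ind2 (fun p q => exists2 c : K, c != 0 & p = c *: q)) => //.
  by exists 1; rewrite ?oner_neq0 ?scale1r.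
move=> p1 q1 p2 q2 [c1 n1 ->] [c2 n2 ->]; exists (c1 * c2).
  by rewrite mulf_neq0.
by rewrite -scalerAl -scalerAr scalerA.
Qed.

(** Multiplication by w ^+ k, a rotation of the polygon, carries the chords
    from 1 to the chords from w ^+ k. *)
Lemma prod_chords (C : numClosedFieldType) (n : nat) (w : C) (k : 'I_n) :
  n.-primitive_root w ->
  \prod_(l < n | l != k)
     (1 + ((w ^+ k - w ^+ l) / `|w ^+ k - w ^+ l|) *: 'X) =
  \prod_(1 <= l < n) (1 + chord_dir w l *: 'X) \Po (w ^+ k *: 'X).
Proof.
case: n k => [[]//|n] k wP.
rewrite (reindex_inj (addrI k)) /= rmorph_prod /= big_add1 /= big_mkord.
rewrite (eq_bigl (fun l : 'I_n.+1 => l != 0)) => [|l]; last first.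
  by rewrite -subr_eq0 addrAC subrr add0r.
rewrite big_mkcond big_ord_recl /= mul1r; apply: eq_bigr => l _.
rewrite rmorphD rmorph1 /= comp_polyZ comp_polyX scalerA; congr (1 + _ *: _).
have -> : w ^+ ((k + bump 0 l) %% n.+1) = w ^+ k * w ^+ l.+1.
  by rewrite (prim_expr_mod wP) exprD.
rewrite -[X in X - _]mulr1 -mulrBr normrM (norm_prim_expr k wP) mul1r /chord_dir.
by rewrite -mulrA mulrC.
Qed.

(** The associated polynomial, up to a scalar, of the vertex 1; the other
    vertices give its rotations. *)
Definition vertex_poly (C : numClosedFieldType) m n (w : C) (lam : 'I_m -> C) :=
  \prod_i (1 + lam i *: 'X) * \prod_(1 <= l < n) (1 + chord_dir w l *: 'X).

Lemma size_linear (C : idomainType) (a : C) : a != 0 -> size (1 + a *: 'X) = 2.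
Proof.
move=> a0; rewrite addrC size_polyDl size_scale ?size_polyX //.
by rewrite size_poly1.
Qed.

(** There are m + n - 1 linear factors with nonzero leading coefficients, so
    the degree is m + n - 1 and no coefficient in this range is missed by
    [pos_coefs]. *)
Lemma vertex_poly_gt0 (C : numClosedFieldType) m n (w : C) (lam : 'I_m -> C) k :
  n.-primitive_root w -> (forall i, 0 < lam i) -> (k < m + n)%N ->
  0 < (vertex_poly n w lam)`_k.
Proof.
move=> wP lam0 kmn; have n0 := prim_order_gt0 wP.
have lin0 (a : C) : a != 0 -> 1 + a *: 'X != 0.
  by move=> a0; rewrite -size_poly_gt0 size_linear.
have ln0 i : lam i != 0 by rewrite gt_eqF.
have ch0 l : (0 < l < n)%N -> chord_dir w l != 0.
  by move=> ln; rewrite mulf_neq0 ?invr_eq0 ?normr_eq0 ?(chord_neq0 wP).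
have s1 : size (\prod_i (1 + lam i *: 'X)) = m.+1.
  rewrite size_prod => [|i _]; last by rewrite lin0.
  rewrite (eq_bigr (fun=> 2)) => [|i _]; last by rewrite size_linear.
  by rewrite sum_nat_const card_ord; lia.
have s2 : size (\prod_(1 <= l < n) (1 + chord_dir w l *: 'X)) = n.
  rewrite size_prod_seq => [|l]; last first.
    by rewrite mem_index_iota => ln; rewrite lin0 ?ch0.
  rewrite (eq_big_seq (fun=> 2)) => [|l]; last first.
    by rewrite mem_index_iota => ln; rewrite size_linear ?ch0.
  by rewrite sum_nat_const_nat size_iota; lia.
have pos : pos_coefs (vertex_poly n w lam).
  apply: pos_coefsM; last exact: pos_coefs_prod_chords.
  apply: (big_ind (@pos_coefs C)); first exact: pos_coefs1.
    exact: pos_coefsM.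
  by move=> i _; apply: pos_coefs_linear.
apply: pos; rewrite /vertex_poly size_mul -?size_poly_gt0 ?s1 ?s2 //.
Qed.

(** The power of X that the axis contributes to the polynomial of the i-th
    point: a point of the axis gives the form X if it is above, and a
    constant otherwise. *)
Definition rank_above (R : realDomainType) m (t : 'I_m -> R) (i : 'I_m) : nat :=
  #|[pred k | t i < t k]|.

Lemma rank_above_lt (R : realDomainType) m (t : 'I_m -> R) i :
  (rank_above t i < m)%N.
Proof.
rewrite -{2}(card_ord m); apply: proper_card; apply/properP; split.
  exact/subsetP.
by exists i => //; rewrite inE ltxx.
Qed.

Definition rank_ord (R : realDomainType) m (t : 'I_m -> R) i :=
  Ordinal (rank_above_lt t i).

Lemma rank_ord_inj (R : realDomainType) m (t : 'I_m -> R) :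
  injective t -> injective (rank_ord t).
Proof.
move=> t_inj; suff dec i k : t i < t k -> (rank_above t k < rank_above t i)%N.
  move=> i k /(congr1 val) /= ik; apply: t_inj.
  by have [/dec|/dec|] := ltgtP (t i) (t k); rewrite ?ik ?ltnn.
move=> ik; apply: proper_card; apply/properP; split.
  by apply/subsetP => l; rewrite !inE; apply: lt_trans.
by exists k; rewrite inE // ltxx.
Qed.

Lemma prod_axial (R : realDomainType) (C : comNzRingType) m (t : 'I_m -> R) i :
  \prod_(k | k != i) (if t i < t k then 'X else 1) = 'X^(rank_above t i) :> {poly C}.
Proof.
rewrite -big_mkcondr /= (eq_bigl [pred k | t i < t k]) => [|k].
  by rewrite prodr_const.
by rewrite /=; have [->|] := eqVneq k i; rewrite ?ltxx.
Qed.

(** Here L i j is the dehomogenized linear form of the pair (i, j), known up to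
    a nonzero scalar.  Multiplying over j and sorting the axis by height and
    the vertices by s reduces the claim to [dihedral_independence]. *)
Lemma normal_form_independence (R : realDomainType) (C : numClosedFieldType)
    (m n : nat) (w : C) (t : 'I_m -> R) (mu lam : 'I_m -> C) (s : 'S_n)
    (L : 'I_(m + n) -> 'I_(m + n) -> {poly C}) :
  n.-primitive_root w -> injective t ->
  (forall i, 0 < mu i) -> (forall i, 0 < lam i) ->
  (forall i k, i != k -> exists2 c : C, c != 0 &
     L (lshift n i) (lshift n k) = c *: (if t i < t k then 'X else 1)) ->
  (forall i j, exists2 c : C, c != 0 &
     L (lshift n i) (rshift m j) = c *: (1 - (mu i * w ^+ s j) *: 'X)) ->
  (forall j i, exists2 c : C, c != 0 &
     L (rshift m j) (lshift n i) = c *: (1 + (lam i * w ^+ s j) *: 'X)) ->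
  (forall j l, j != l -> exists2 c : C, c != 0 &
     L (rshift m j) (rshift m l) =
       c *: (1 + ((w ^+ s j - w ^+ s l) / `|w ^+ s j - w ^+ s l|) *: 'X)) ->
  lin_indep (fun i => \prod_(j | j != i) L i j).
Proof.
move=> wP t_inj mu0 lam0 Lxx Lxy Lyx Lyy.
pose Q := vertex_poly n w lam.
have px i : exists2 c : C, c != 0 & \prod_(j | j != lshift n i) L (lshift n i) j =
    c *: ('X^(rank_ord t i) * (1 - mu i ^+ n *: 'X^n)).
  rewrite big_split_ord /=.
  rewrite [X in X * _](eq_bigl (fun k => k != i)) => [|k]; last first.
    by rewrite (inj_eq (@lshift_inj _ _)).
  rewrite [X in _ * X](eq_bigl xpredT) => [|j]; last by rewrite eq_rlshift.
  have [|c1 n1 ->] := @scaled_prod C _ (fun k => k != i)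
    (fun k => L (lshift n i) (lshift n k)) (fun k => if t i < t k then 'X else 1).
    by move=> k ki; apply: Lxx; rewrite eq_sym.
  have [|c2 n2 ->] := @scaled_prod C _ xpredT
    (fun j => L (lshift n i) (rshift m j)) (fun j => 1 - (mu i * w ^+ s j) *: 'X).
    by move=> j _; apply: Lxy.
  exists (c1 * c2); first by rewrite mulf_neq0.
  rewrite prod_axial -scalerAl -scalerAr scalerA; congr (_ *: (_ * _)).
  rewrite -(prod_one_sub_prim (mu i) wP) [RHS](reindex_inj (@perm_inj _ s)).
  by apply: eq_bigr.
have py j : exists2 c : C, c != 0 & \prod_(k | k != rshift m j) L (rshift m j) k =
    c *: (Q \Po (w ^+ s j *: 'X)).
  rewrite big_split_ord /=.
  rewrite [X in X * _](eq_bigl xpredT) => [|i]; last by rewrite eq_lrshift.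
  rewrite [X in _ * X](eq_bigl (fun l => l != j)) => [|l]; last first.
    by rewrite (inj_eq (@rshift_inj _ _)).
  have [|c1 n1 ->] := @scaled_prod C _ xpredT
    (fun i => L (rshift m j) (lshift n i)) (fun i => 1 + (lam i * w ^+ s j) *: 'X).
    by move=> i _; apply: Lyx.
  have [|c2 n2 ->] := @scaled_prod C _ (fun l => l != j)
    (fun l => L (rshift m j) (rshift m l)) (fun l =>
    1 + ((w ^+ s j - w ^+ s l) / `|w ^+ s j - w ^+ s l|) *: 'X).
    by move=> l lj; apply: Lyy; rewrite eq_sym.
  exists (c1 * c2); first by rewrite mulf_neq0.
  rewrite -scalerAl -scalerAr scalerA; congr (_ *: _).
  rewrite /Q /vertex_poly rmorphM /= -prod_chords // rmorph_prod /=.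
  congr (_ * _).
    apply: eq_bigr => i _.
    by rewrite rmorphD rmorph1 /= comp_polyZ comp_polyX scalerA.
  rewrite [RHS](reindex_inj (@perm_inj _ s)); apply: eq_bigl => l.
  by rewrite (inj_eq perm_inj).
have [cx cx0 cxE] := fin_all_exists2 px; have [cy cy0 cyE] := fin_all_exists2 py.
move=> a; rewrite big_split_ord /= => rel.
pose r := perm (rank_ord_inj t_inj).
have rK i : (r^-1)%g (r i) = i by rewrite permK.
have [|||A0 B0] := @dihedral_independence C m n w
   (fun k => mu ((r^-1)%g k) ^+ n)
   (fun k => a (lshift n ((r^-1)%g k)) * cx ((r^-1)%g k)) Q
   (fun k => a (rshift m ((s^-1)%g k)) * cy ((s^-1)%g k)) wP.
- by move=> k; rewrite exprn_gt0.
- by move=> k; apply: vertex_poly_gt0.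
- rewrite -[RHS]rel (reindex_inj (@perm_inj _ r)) /=; congr (_ + _).
    by apply: eq_bigr => i _; rewrite rK cxE scalerA permE.
  rewrite (reindex_inj (@perm_inj _ s)) /=.
  by apply: eq_bigr => j _; rewrite permK cyE scalerA.
move=> i; case: (split_ordP i) => k ->.
  by have /eqP := A0 (r k); rewrite rK mulf_eq0 (negPf (cx0 k)) orbF => /eqP.
by have /eqP := B0 (s k); rewrite permK mulf_eq0 (negPf (cy0 k)) orbF => /eqP.
Qed.

(** * The configuration *)

Local Open Scope complex_scope.

Lemma expr_cos_sin (R : realType) (kappa : R[i]) (n k : nat) :
  kappa ^+ 2 = -1 ->
  ((cos (2 * pi / n%:R))%:C - kappa * (sin (2 * pi / n%:R))%:C) ^+ k =
  (cos (2 * pi * k%:R / n%:R))%:C - kappa * (sin (2 * pi * k%:R / n%:R))%:C.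
Proof.
move=> k2; elim: k => [|k IH].
  by rewrite !(mulr0, mul0r) cos0 sin0 mulr0 subr0.
have -> : 2 * pi * k.+1%:R / n%:R = 2 * pi / n%:R + 2 * pi * k%:R / n%:R :> R.
  by rewrite -(addn1 k) (natrD _ k) (mulrDr (2 * pi)) mulr1 mulrDl addrC.
rewrite exprS IH cosD sinD !rmorphD !rmorphN !rmorphM /=.
set c := (cos _)%:C; set s := (sin _)%:C.
set c' := (cos _)%:C; set s' := (sin _)%:C.
by ring: k2.
Qed.

(** For either square root kappa of -1; the value 1 is excluded for
    0 < k < n because the sine of half the angle is positive. *)
Lemma prim_root_cos_sin (R : realType) (kappa : R[i]) (n : nat) :
  (0 < n)%N -> kappa ^+ 2 = -1 ->
  n.-primitive_root
    ((cos (2 * pi / n%:R))%:C - kappa * (sin (2 * pi / n%:R))%:C).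
Proof.
move=> n0 k2; have nn0 : (n%:R : R) != 0 by rewrite pnatr_eq0 -lt0n.
apply/andP; split=> //; apply/forallP => i; apply/eqP.
rewrite unity_rootE expr_cos_sin //.
have [->|i1] := eqVneq i.+1 n.
  by rewrite mulfK // mulr_natl cos2pi sin2pi mulr0 subr0 eqxx.
have in1 : (i.+1 < n)%N by rewrite ltn_neqAle i1 ltn_ord.
apply/negbTE/negP => /eqP; set th := _ / _ => cs.
have c1 : cos th = 1.
  have E : (cos th)%:C + kappa * (sin th)%:C = 1.
    rewrite -[LHS]mul1r -{1}cs.
    have -> : ((cos th)%:C - kappa * (sin th)%:C) *
        ((cos th)%:C + kappa * (sin th)%:C) =
        (cos th)%:C ^+ 2 - kappa ^+ 2 * (sin th)%:C ^+ 2 by ring.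
    by rewrite k2 mulN1r opprK -!rmorphXn -rmorphD /= cos2Dsin2.
  apply: complexI; rewrite rmorph1; apply: (mulfI (x := 2)).
    by rewrite pnatr_eq0.
  have -> : 2 * (cos th)%:C =
      ((cos th)%:C - kappa * (sin th)%:C) + ((cos th)%:C + kappa * (sin th)%:C).
    by ring.
  by rewrite cs E mulr1.
have th2 : th = (th / 2) *+ 2 by rewrite -mulr_natr divfK // pnatr_eq0.
have s0 : 0 < sin (th / 2).
  have -> : th / 2 = pi * (i.+1%:R / n%:R) by rewrite /th; field.
  have n0R : (0 : R) < n%:R by rewrite ltr0n.
  apply: sin_gt0_pi; rewrite mulr_gt0 ?pi_gt0 ?divr_gt0 ?ltr0n //=.
  by rewrite gtr_pMr ?pi_gt0 // ltr_pdivrMr // mul1r ltr_nat.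
have c2 : cos (th / 2) ^+ 2 = 1.
  move: c1; rewrite {1}th2 cos_mulr2n => /eqP.
  by rewrite subr_eq -[1 + 1]/(1 *+ 2) eqrMn2r => /eqP.
by have := exprn_gt0 2 s0; rewrite sin2cos2 c2 subrr ltxx.
Qed.

(** The vertices are at E * w ^+ s j in the plane of the polygon, with E its
    radius.  The slopes of the forms between the axis and the vertices are
    E / (length - height), where the sign of the height depends on which of
    the two points comes first. *)
Theorem theorem3p1 (R : realType) (m n : nat) (hn : (0 < n)%N)
    (x : 'I_(m + n) -> 'rV[R]_3) (hx : injective x)
    (o d : 'rV[R]_3) (hd : d != 0)
    (hline : forall i : 'I_m, on_line o d (x (lshift n i)))
    (c e f : 'rV[R]_3)
    (hpoly : regular_polygon c e f (fun j : 'I_n => x (rshift m j)))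
    (hperp : dot d e = 0 /\ dot d f = 0)
    (hc : on_line o d c)
    (u v : 'I_(m + n) -> 'I_(m + n) -> R[i])
    (huv : forall i j : 'I_(m + n), i != j ->
       cp1_coords (u i j) (v i j) (x j - x i)) :
  lin_indep (assoc_poly u v).
Proof.
have [en0 eef def [s ys]] := hpoly; have [ded dff] := hperp.
have [t0 cE] := hc; have [t tE] := fin_all_exists hline.
have [g [kappa [D [E [k2 D0 E0 gP]]]]] := adapted_frame hd en0 eef def ded dff.
pose w := (cos (2 * pi / n%:R))%:C - kappa * (sin (2 * pi / n%:R))%:C.
have wP : n.-primitive_root w by apply: prim_root_cos_sin.
(* In adapted coordinates cos e + sin f has radial part a multiple of w ^+ j,
   and the opposite sign of kappa gives its conjugate. *)
pose co (j : 'I_n) := cos (2 * pi * j%:R / n%:R) : R.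
pose si (j : 'I_n) := sin (2 * pi * j%:R / n%:R) : R.
have wE (j : 'I_n) : w ^+ j = (co j)%:C - kappa * (si j)%:C by apply: expr_cos_sin.
have wJ (j : 'I_n) : (w ^+ j)^-1 = (co j)%:C + kappa * (si j)%:C.
  apply: (mulfI (prim_expr_neq0 j wP)); rewrite divff ?(prim_expr_neq0 j wP) //.
  rewrite wE.
  have -> : ((co j)%:C - kappa * (si j)%:C) * ((co j)%:C + kappa * (si j)%:C)
      = (co j)%:C ^+ 2 - kappa ^+ 2 * (si j)%:C ^+ 2 by ring.
  by rewrite k2 mulN1r opprK -!rmorphXn -rmorphD /= cos2Dsin2.
have form i j (a b b' : R) : i != j -> x j - x i = a *: d + b *: e + b' *: f ->
    exists al be rho : R[i],
      dehomog g (linear_form (u i j) (v i j)) = be%:P - al *: 'X /\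
      eigen_coords (a * D)%:C (E%:C * (b%:C - kappa * b'%:C))
        (E%:C * (b%:C + kappa * b'%:C)) rho al be.
  move=> ij xE; have [||al [be [rho [eq1 ? ? ? ?]]]] := gP (u i j) (v i j) a b b'.
  - by rewrite -xE; apply: huv.
  - by rewrite -xE subr_eq0 (inj_eq hx) eq_sym.
  by exists al, be, rho; split.
have DC : (0 : R[i]) < D%:C by rewrite ltcR.
have EC : (0 : R[i]) < E%:C by rewrite ltcR.
pose q (a : R) := sqrtC ((a * D)%:C ^+ 2 + E%:C ^+ 2) - (a * D)%:C.
have realC (a : R) : a%:C \is Num.real by apply/complex_realP; exists a.
have q0 a : 0 < q a by apply: oblique_gt0; rewrite ?exprn_gt0.
have wV (j : 'I_n) : w ^+ j * (w ^+ j)^-1 = 1.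
  by rewrite divff // (prim_expr_neq0 j wP).
pose L i j := dehomog g (linear_form (u i j) (v i j)).
have LE i : dehomog g (assoc_poly u v i) = \prod_(j | j != i) L i j.
  by rewrite /assoc_poly rmorph_prod.
move=> a0 rel; have relL : \sum_i a0 i *: \prod_(j | j != i) L i j = 0.
  have := congr1 (dehomog g) rel; rewrite raddf_sum raddf0 /= => rel'.
  rewrite -[RHS]rel'; by apply: eq_bigr => i _; rewrite dehomogZ LE.
have ind : lin_indep (fun i => \prod_(j | j != i) L i j); last exact: ind relL.
apply: (@normal_form_independence R _ m n w t
  (fun i => E%:C / q (t0 - t i)) (fun i => E%:C / q (t i - t0)) s) => //.
- move=> i k ik; apply: (@lshift_inj m n); apply: hx.
  by rewrite !tE ik.
- by move=> i; rewrite divr_gt0.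
- by move=> i; rewrite divr_gt0.
- move=> i k ik; rewrite /L; have [||al [be [rho [-> eig]]]] :=
    form (lshift n i) (lshift n k) (t k - t i) 0 0.
  + by rewrite (inj_eq (@lshift_inj _ _)).
  + by rewrite !tE !scale0r !addr0 scalerBl opprD addrACA subrr add0r.
  move: eig; rewrite mulr0 subr0 addr0 mulr0 => eig.
  case: ltgtP => [lt_ik|lt_ki|/esym tik].
  + by apply: (form_axial_pos eig); rewrite ltcR mulr_gt0 ?subr_gt0.
  + by apply: (form_axial_neg eig); rewrite ltcR pmulr_llt0 ?subr_lt0.
  by case/eqP: ik; apply: (@lshift_inj m n); apply: hx; rewrite !tE tik.
- move=> i j; rewrite /L; have [||al [be [rho [-> eig]]]] :=
    form (lshift n i) (rshift m j) (t0 - t i) (co (s j)) (si (s j)).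
  + by rewrite eq_lrshift.
  + by rewrite ys tE cE scalerBl; apply/rowP => k; rewrite !mxE /co /si; ring.
  move: eig; rewrite -wE -wJ => eig.
  have ss : E%:C * w ^+ s j * (E%:C * (w ^+ s j)^-1) = E%:C ^+ 2.
    by rewrite mulrACA wV mulr1.
  have [] := form_oblique eig (realC _); first by rewrite ss exprn_gt0.
  rewrite ss => c0 c00 ->; exists c0 => //; congr (_ *: (1 - _ *: _)).
  by rewrite mulrAC.
- move=> j i; rewrite /L; have [||al [be [rho [-> eig]]]] :=
    form (rshift m j) (lshift n i) (t i - t0) (- co (s j)) (- si (s j)).
  + by rewrite eq_rlshift.
  + by rewrite ys tE cE scalerBl; apply/rowP => k; rewrite !mxE /co /si; ring.
  have es : (- co (s j))%:C - kappa * (- si (s j))%:C = - w ^+ s j.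
    by rewrite wE !rmorphN /=; ring.
  have es' : (- co (s j))%:C + kappa * (- si (s j))%:C = - (w ^+ s j)^-1.
    by rewrite wJ !rmorphN /=; ring.
  move: eig; rewrite es es' => eig.
  have ss : E%:C * - w ^+ s j * (E%:C * - (w ^+ s j)^-1) = E%:C ^+ 2.
    by rewrite mulrACA mulrNN wV mulr1.
  have [] := form_oblique eig (realC _); first by rewrite ss exprn_gt0.
  rewrite ss => c0 c00 ->; exists c0 => //; congr (_ *: _).
  by rewrite mulrN mulNr scaleNr opprK mulrAC.
move=> j l jl; rewrite /L; have [||al [be [rho [-> eig]]]] :=
    form (rshift m j) (rshift m l) 0 (co (s l) - co (s j)) (si (s l) - si (s j)).
- by rewrite (inj_eq (@rshift_inj _ _)).
- by rewrite !ys; apply/rowP => k; rewrite !mxE /co /si; ring.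
move: eig; rewrite mul0r.
have -> : (co (s l) - co (s j))%:C - kappa * (si (s l) - si (s j))%:C =
    w ^+ s l - w ^+ s j.
  by rewrite !wE !rmorphB /=; ring.
have -> : (co (s l) - co (s j))%:C + kappa * (si (s l) - si (s j))%:C =
    (w ^+ s l - w ^+ s j)^*%R.
  by rewrite (conj_prim_exprB _ _ wP) !wJ !rmorphB /=; ring.
move=> eig.
have ww0 : w ^+ s l - w ^+ s j != 0.
  rewrite subr_eq0 (eq_prim_root_expr wP) !modn_small //.
  by rewrite (inj_eq val_inj) (inj_eq perm_inj) eq_sym.
have ss : E%:C * (w ^+ s l - w ^+ s j) * (E%:C * (w ^+ s l - w ^+ s j)^*%R) =
    (E%:C * `|w ^+ s l - w ^+ s j|) ^+ 2.
  by rewrite mulrACA -normCK -expr2 -exprMn.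
have Ew0 : 0 < E%:C * `|w ^+ s l - w ^+ s j| by rewrite mulr_gt0 ?normr_gt0.
have [] := form_oblique eig (realC _); first by rewrite ss exprn_gt0.
rewrite ss rmorph0 expr0n add0r subr0 sqrCK ?(ltW Ew0) // => c0 c00 ->.
exists c0 => //; congr (_ *: _).
rewrite -scaleNr; congr (1 + _ *: _).
rewrite (distrC (w ^+ s j)) -(opprB (w ^+ s l)) mulNr; congr (- _).
by rewrite invfM mulrACA divff ?mul1r // gt_eqF.
Qed.
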